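(* Let $T$ be a $\mu$-invariant Markov kernel on $(E,\mathscr{E})$. Then $T$ satisfies a $\|\cdot\|_{\mathrm{osc}}^2$-WPI if and only if $T$ is RUPI (resolvent-uniform-positivity-improving).
   Context: $(E,\mathscr{E})$ is a measurable space with measurable diagonal, $\mu$ a probability measure on it. $L^2_0(\mu)$ is the set of real $f\in L^2(\mu)$ with $\mu(f)=0$; $\|f\|_{\mathrm{osc}}=\mathrm{ess}_\mu\sup f-\mathrm{ess}_\mu\inf f\in[0,\infty]$; $\mathcal{E}(T,f)=\langle(\mathrm{Id}-T)f,f\rangle$ in $L^2(\mu)$. $\|\cdot\|_{\mathrm{osc}}^2$-WPI for $T$ (not necessarily reversible): there is a decreasing (non-increasing) $\alpha:(0,\infty)\to[0,\infty)$ with $\|f\|_2^2\le\alpha(r)\mathcal{E}(T,f)+r\|f\|_{\mathrm{osc}}^2$ for all $r>0$ and $f\in L^2_0(\mu)$. UPI: a kernel $R$ is uniform-positivity-improving if for each $\epsilon>0$, $\inf\{\langle\mathbf{1}_A,R\mathbf{1}_B\rangle:A,B\in\mathscr{E},\ \mu(A)\wedge\mu(B)\ge\epsilon\}>0$. RUPI: $T$ is RUPI if for some (and hence all) $0<\lambda<1$, the resolvent $R(\lambda,T)=\sum_{n=0}^\infty\lambda^nT^n=(\mathrm{Id}-\lambda T)^{-1}$ is UPI. *)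

(* Defs.v *)
From HB Require Import structures.
From mathcomp Require Import all_boot all_order all_algebra.
From mathcomp Require Import all_classical all_reals all_analysis.
From mathcomp Require Import measurable_realfun ess_sup_inf.

Set Implicit Arguments.
Unset Strict Implicit.
Unset Printing Implicit Defensive.
Import Order.TTheory GRing.Theory Num.Theory.
Import numFieldNormedType.Exports.

Local Open Scope classical_set_scope.
Local Open Scope ring_scope.
Local Open Scope ereal_scope.

Section kernels.
Context {d : measure_display} {E : measurableType d} {R : realType}.

(* For f in L^2(mu) and K a mu-invariant Markov kernel, f is K x-integrable for
   mu-almost every x, so the value at the other points is immaterial. *)
Definition kact (K : R.-ker E ~> E) (f : E -> \bar R) (x : E) : \bar R :=
  \int[K x]_y f y.

Definition invariant_measure (mu : {measure set E -> \bar R}) (K : R.-ker E ~> E) :=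
  forall A, measurable A -> \int[mu]_x K x A = mu A.

Fixpoint kpow (T : R.-spker E ~> E) (n : nat) : R.-spker E ~> E :=
  match n with
  | 0%N => kdirac (@measurable_id _ E setT)
  | n'.+1 => mkcomp_noparam T (kpow T n')
  end.

Section kscale.
Variables (r : {nonneg R}) (K : R.-ker E ~> E).

Definition kscale (x : E) : {measure set E -> \bar R} := mscale r (K x).

Let measurable_kscale U :
  measurable U -> measurable_fun [set: E] (kscale ^~ U).
Proof.
by move=> mU; apply: measurable_funeM; exact: measurable_kernel.
Qed.

HB.instance Definition _ :=
  isKernel.Build _ _ _ _ R kscale measurable_kscale.

End kscale.

(* If T is mu-invariant and l < 1, the operator induced on L^2(mu) is
   (Id - l T)^-1. *)
Definition resolvent (l : {posnum R}) (T : R.-spker E ~> E) : R.-ker E ~> E :=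
  kseries (fun n => kscale (l%:num ^+ n)%:nng%R (kpow T n)).

End kernels.

Section L2.
Context {d : measure_display} {E : measurableType d} {R : realType}.
Variable mu : {measure set E -> \bar R}.

Definition inner (f g : E -> \bar R) : \bar R := \int[mu]_x (f x * g x).

Definition L20 : set (E -> R) :=
  [set f | f \in Lfun mu 2%:E /\ \int[mu]_x (f x)%:E = 0].

Definition osc (f : E -> R) : \bar R := ess_supr mu f - ess_infr mu f.

Definition dirichlet (T : R.-ker E ~> E) (f : E -> R) : \bar R :=
  inner ((EFin \o f) \- kact T (EFin \o f)) (EFin \o f).

(* Both sides are extended reals: when osc f = +oo the inequality is void,
   since r > 0. *)
Definition osc2_WPI (T : R.-ker E ~> E) : Prop :=
  exists alpha : R -> R,
    [/\ forall r : R, (0 < r)%R -> (0 <= alpha r)%R,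
        forall r s : R, (0 < r)%R -> (r <= s)%R -> (alpha s <= alpha r)%R &
        forall (r : R) (f : E -> R), (0 < r)%R -> L20 f ->
          'N[mu]_2%:E[EFin \o f] ^+ 2 <=
            (alpha r)%:E * dirichlet T f + r%:E * osc f ^+ 2].

(* When eps > mu E no pair A, B is admissible and the infimum is +oo. *)
Definition UPI (K : R.-ker E ~> E) : Prop :=
  forall eps : R, (0 < eps)%R ->
    0 < ereal_inf [set z | exists A B : set E,
      [/\ measurable A, measurable B,
          eps%:E <= Order.min (mu A) (mu B) &
          z = inner (EFin \o \1_A) (kact K (EFin \o \1_B))]].

(* For invariant T the property does not depend on the choice of l in ]0, 1[. *)
Definition RUPI (T : R.-spker E ~> E) : Prop :=
  exists l : {posnum R}, (l%:num < 1)%R /\ UPI (resolvent l T).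

End L2.

(* Main.v *)
Require Import Defs.
From HB Require Import structures.
From mathcomp Require Import all_boot all_order all_algebra.
From mathcomp Require Import all_classical all_reals all_analysis.
From mathcomp Require Import measurable_realfun ess_sup_inf ring lra.

(* Write [E(f)] for the Dirichlet form and [s = mu |f - T f|].

   RUPI -> WPI. For bounded [f], Cauchy-Schwarz gives [s^2 <= 2 E(f)], and
   invariance gives [mu |f - T^n f| <= n s]. If [mu f = 0], [|f| <= 1] and
   [mu (f^2) >= r], the sets [A = {f >= r/4}] and [B = {f <= - r/4}] have mass at
   least [r/4], and [(r/2)^2 <1_A, T^n 1_B> <= 2 <f - T^n f, f> <= 2 n s].
   Summing against [l^n], the positivity of the resolvent bounds [s], hence
   [E(f)], from below by a constant depending only on [r]; scaling turns this
   into the weak Poincare inequality.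

   WPI -> RUPI. Let [g = sum_(n <= N) q^n T^n 1_B] with [q] close to [1] and then
   [N] large, and [h = min(g, 1)]. Since [q T h <= h + q^(N+1)], the energy of
   [h] is at most [(1/q - 1) + q^N], which is small. If [mu A, mu B >= eps] and
   [<1_A, g>] were less than [eps/2], then [h], being [1] on [B] and small on
   average on [A], would have variance at least [eps^2/16], against the weak
   Poincare inequality. Thus [<1_A, g> >= eps/2], and the resolvent at [l = 1/2]
   dominates [2^-N g]. *)

Set Implicit Arguments.
Unset Strict Implicit.
Unset Printing Implicit Defensive.
Import Order.TTheory GRing.Theory Num.Theory.
Import numFieldNormedType.Exports.

Local Open Scope classical_set_scope.
Local Open Scope ring_scope.

(** * Integration against a mixture of kernel measures *)

Section bind.
Context d1 d2 (X : measurableType d1) (Y : measurableType d2) (R : realType).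
Variables (m : {measure set X -> \bar R}) (m' : {measure set Y -> \bar R}).
Variable K : R.-ker X ~> Y.
Hypothesis mK : forall A, measurable A -> m' A = (\int[m]_x K x A)%E.

Import HBNNSimple.

Let ge0_integral_bind_nnsfun (f : {nnsfun Y >-> R}) :
  (\int[m']_y (f y)%:E = \int[m]_x \int[K x]_y (f y)%:E)%E.
Proof.
transitivity
  (\int[m]_x \sum_(r \in range f) (r%:E * K x (f @^-1` [set r])))%E; last first.
  by apply: eq_integral => x _; rewrite integralT_nnsfun sintegralE.
rewrite integralT_nnsfun sintegralE ge0_integral_fsum//.
- apply: eq_fsbigr => r _.
  have [r0|r0] := leP 0%R r.
    rewrite ge0_integralZl//; last exact: measurable_kernel.
    by rewrite mK.
  by rewrite preimage_nnfun0// measure0 mule0 integral0_eq// => x _;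
    rewrite measure0 mule0.
- by move=> r; apply: measurable_funeM; exact: measurable_kernel.
- by move=> r x _; exact: nnsfun_mulemu_ge0.
Qed.

(** Monotone convergence along increasing simple approximations, in both the inner and the outer
    integral, reduces this to simple functions. *)
Lemma ge0_integral_bind (f : Y -> \bar R) :
  measurable_fun setT f -> (forall y, 0 <= f y)%E ->
  (\int[m']_y f y = \int[m]_x \int[K x]_y f y)%E.
Proof.
move=> mf f0.
pose f_ := nnsfun_approx measurableT mf.
have f_lim (P : {measure set Y -> \bar R}) :
    (\int[P]_y (f_ n y)%:E)%E @[n --> \oo] --> (\int[P]_y f y)%E.
  rewrite [X in _ --> X](_ : _ = \int[P]_y lim ((f_ n y)%:E @[n --> \oo]))%E.
    apply: cvg_monotone_convergence => //.
    - by move=> n; exact/measurable_EFinP.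
    - by move=> n y _; rewrite lee_fin.
    - by move=> y _ a b ab; rewrite lee_fin; exact/lefP/nd_nnsfun_approx.
  by apply/eq_integral => y _; apply/esym/cvg_lim => //; exact: cvg_nnsfun_approx.
have nd x : {homo (fun n => \int[K x]_y (f_ n y)%:E)%E :
    a b / (a <= b)%N >-> (a <= b)%E}.
  move=> a b ab; apply: ge0_le_integral => //.
  - by move=> y _; rewrite lee_fin.
  - exact/measurable_EFinP.
  - exact/measurable_EFinP.
  - by move=> y _; rewrite lee_fin; exact/lefP/nd_nnsfun_approx.
transitivity (\int[m]_x lim ((\int[K x]_y (f_ n y)%:E)%E @[n --> \oo]))%E; last first.
  by apply: eq_integral => x _; apply/cvg_lim => //; exact: f_lim.
rewrite monotone_convergence//.
- apply/esym/cvg_lim => //.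
  rewrite [X in X @ _](_ : _ = (fun n => \int[m']_y (f_ n y)%:E)%E); first exact: f_lim.
  by apply/funext => n; rewrite ge0_integral_bind_nnsfun.
- move=> n; apply: measurable_fun_integral_kernel.
  + by move=> U mU; exact: measurable_kernel.
  + by move=> y; rewrite lee_fin.
  + exact/measurable_EFinP.
- by move=> n x _; apply: integral_ge0 => y _; rewrite lee_fin.
Qed.

End bind.

(** * The algebra of bounded measurable functions *)

Section bounded_measurable.
Context d (E : measurableType d) (R : realType).
Implicit Types (f g : E -> R) (c : R).

(** On this class all integrals against a probability measure are finite and Markov operators act,
    so the estimates can be carried out in [R]. *)
Definition bmf f := measurable_fun setT f /\ exists M : R, forall x, `|f x| <= M.

Lemma bmf_cst c : bmf (fun=> c).
Proof. by split; [exact: measurable_cst|exists `|c|]. Qed.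

Lemma bmfD f g : bmf f -> bmf g -> bmf (fun x => f x + g x).
Proof.
move=> [mf [M fM]] [mg [N gN]]; split; first exact: measurable_funD.
by exists (M + N) => x; rewrite (le_trans (ler_normD _ _))// lerD.
Qed.

Lemma bmfN f : bmf f -> bmf (fun x => - f x).
Proof.
move=> [mf [M fM]]; split; first exact: measurableT_comp.
by exists M => x; rewrite normrN.
Qed.

Lemma bmfB f g : bmf f -> bmf g -> bmf (fun x => f x - g x).
Proof. by move=> bf /bmfN; exact: bmfD. Qed.

Lemma bmfM f g : bmf f -> bmf g -> bmf (fun x => f x * g x).
Proof.
move=> [mf [M fM]] [mg [N gN]]; split; first exact: measurable_funM.
by exists (M * N) => x; rewrite normrM ler_pM.
Qed.

Lemma bmf_norm f : bmf f -> bmf (fun x => `|f x|).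
Proof.
move=> [mf [M fM]]; split; first exact: measurableT_comp.
by exists M => x; rewrite normr_id.
Qed.

Lemma bmf_min f g : bmf f -> bmf g -> bmf (fun x => Num.min (f x) (g x)).
Proof.
move=> [mf [M fM]] [mg [N gN]]; split; first exact: measurable_minr.
exists (M + N) => x; have := fM x; have := gN x.
have := normr_ge0 (f x); have := normr_ge0 (g x).
by rewrite minElt; case: ifP => _; lra.
Qed.

Lemma bmf_sum (F : nat -> E -> R) n : (forall i, bmf (F i)) ->
  bmf (fun x => \sum_(i < n) F i x).
Proof.
move=> bF; elim: n => [|n ih].
  under [X in bmf X]eq_fun do rewrite big_ord0; exact: bmf_cst.
by under [X in bmf X]eq_fun do rewrite big_ord_recr/=; exact: bmfD.
Qed.

Lemma bmf_indic (A : set E) : measurable A -> bmf (\1_A : E -> R).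
Proof.
move=> mA; split; first exact: measurable_indic.
by exists 1 => x; rewrite indicE normr_nat; case: (_ \in _).
Qed.

End bounded_measurable.

(** * Real-valued integrals against a measure of mass one *)

Section probability_integral.
Context d (E : measurableType d) (R : realType).
Variable m : {measure set E -> \bar R}.
Hypothesis m1 : m setT = 1%E.
Implicit Types (f g : E -> R) (c : R).

Lemma bmf_integrable f : bmf f -> m.-integrable setT (EFin \o f).
Proof.
move=> [mf [M fM]]; apply: measurable_bounded_integrable => //.
  by rewrite m1 ltry.
exists M; split; first exact: num_real.
by move=> N MN x _; exact: le_trans (fM x) (ltW MN).
Qed.

Lemma EFin_Rintegral f : bmf f ->
  (\int[m]_x f x)%R%:E = (\int[m]_x (f x)%:E)%E.
Proof. by move=> /bmf_integrable fi; rewrite fineK// integrable_fin_num. Qed.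

Lemma bmf_intD f g : bmf f -> bmf g ->
  \int[m]_x (f x + g x) = \int[m]_x f x + \int[m]_x g x.
Proof. by move=> bf bg; rewrite RintegralD//; exact: bmf_integrable. Qed.

Lemma bmf_intB f g : bmf f -> bmf g ->
  \int[m]_x (f x - g x) = \int[m]_x f x - \int[m]_x g x.
Proof. by move=> bf bg; rewrite RintegralB//; exact: bmf_integrable. Qed.

Lemma bmf_intZ c f : bmf f -> \int[m]_x (c * f x) = c * \int[m]_x f x.
Proof. by move=> bf; rewrite RintegralZl//; exact: bmf_integrable. Qed.

Lemma prob_int_cst c : \int[m]_x (cst c x) = c.
Proof. by rewrite Rintegral_cst// m1 mulr1. Qed.

Lemma bmf_int_le f g : bmf f -> bmf g -> (forall x, f x <= g x) ->
  \int[m]_x f x <= \int[m]_x g x.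
Proof. by move=> bf bg fg; apply: le_Rintegral => //; exact: bmf_integrable. Qed.

Lemma bmf_int_norm f : bmf f -> `|\int[m]_x f x| <= \int[m]_x `|f x|.
Proof. by move=> bf; apply: le_normr_Rintegral => //; exact: bmf_integrable. Qed.

Lemma bmf_int_sum (F : nat -> E -> R) n : (forall i, bmf (F i)) ->
  \int[m]_x (\sum_(i < n) F i x) = \sum_(i < n) \int[m]_x F i x.
Proof.
move=> bF; elim: n => [|n ih].
  under eq_Rintegral do rewrite big_ord0.
  by rewrite big_ord0 (prob_int_cst 0).
under eq_Rintegral do rewrite big_ord_recr/=.
by rewrite bmf_intD ?ih ?big_ord_recr//; exact: bmf_sum.
Qed.

Lemma prob_int_indic (A : set E) : measurable A ->
  (\int[m]_x \1_A x)%R%:E = m A.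
Proof.
move=> mA; rewrite EFin_Rintegral ?integral_indic ?setIT//.
exact: bmf_indic.
Qed.

(** Expand the integral of [(f - c)^2 >= 0], where [c] is the mean of [f]. *)
Lemma sqr_int_le f : bmf f -> (\int[m]_x f x) ^+ 2 <= \int[m]_x (f x ^+ 2).
Proof.
move=> bf; set c := \int[m]_x f x.
have bf2 : bmf (fun x => f x ^+ 2) by exact: bmfM.
have : 0 <= \int[m]_x (f x ^+ 2 - (2 * c) * f x + cst (c ^+ 2) x).
  by apply: Rintegral_ge0 => x _ /=; have := sqr_ge0 (f x - c); lra.
have b2 : bmf (fun x => 2 * c * f x) by apply: bmfM => //; exact: bmf_cst.
rewrite bmf_intD; [|exact: bmfB|exact: bmf_cst].
rewrite bmf_intB// bmf_intZ// prob_int_cst -/c; lra.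
Qed.

End probability_integral.

(** * Markov operators on bounded functions *)

Section kernel_action.
Context d (E : measurableType d) (R : realType).
Implicit Types (f g : E -> R) (K : R.-ker E ~> E).

Definition act K f x := \int[K x]_y f y.

Lemma measurable_kact K (f : E -> \bar R) :
  measurable_fun setT f -> measurable_fun setT (kact K f).
Proof.
move=> mf; rewrite /kact.
under eq_fun do rewrite integralE.
apply: emeasurable_funB; apply: measurable_fun_integral_kernel => //.
- by move=> U mU; exact: measurable_kernel.
- exact: measurable_funepos.
- by move=> U mU; exact: measurable_kernel.
- exact: measurable_funeneg.
Qed.

Section markov.
Variable K : R.-ker E ~> E.
Hypothesis K1 : forall x, K x setT = 1%E.

Lemma EFin_act f x : bmf f -> (act K f x)%:E = kact K (EFin \o f) x.
Proof. by move=> bf; rewrite /act EFin_Rintegral. Qed.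

Lemma act_le f g x : bmf f -> bmf g -> (forall y, f y <= g y) ->
  act K f x <= act K g x.
Proof. by move=> bf bg fg; exact: bmf_int_le. Qed.

Lemma act_cst c x : act K (fun=> c) x = c.
Proof. exact: prob_int_cst. Qed.

Lemma bmf_act f : bmf f -> bmf (act K f).
Proof.
move=> bf; have [mf [M fM]] := bf; split.
  apply/measurable_EFinP; rewrite (_ : _ \o _ = kact K (EFin \o f)).
    by apply: measurable_kact; exact/measurable_EFinP.
  by apply/funext => x /=; rewrite EFin_act.
exists M => x; rewrite ler_norml; apply/andP; split.
  rewrite -[leLHS](act_cst _ x); apply: act_le => //; first exact: bmf_cst.
  by move=> y; have := fM y; rewrite ler_norml => /andP[].
rewrite -[leRHS](act_cst _ x); apply: act_le => //; first exact: bmf_cst.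
by move=> y; have := fM y; rewrite ler_norml => /andP[].
Qed.

(** Adding a bound [M] of [|f|] gives a nonnegative function, to which [ge0_integral_bind] applies.
    Two measures are allowed so as to cover both invariance ([m = m' = mu]) and composition of
    kernels. *)
Lemma int_bind (m m' : {measure set E -> \bar R}) f :
  m setT = 1%E -> m' setT = 1%E ->
  (forall A, measurable A -> m' A = \int[m]_x K x A)%E ->
  bmf f -> \int[m']_x f x = \int[m]_x act K f x.
Proof.
move=> m1 m'1 mK bf; have [mf [M fM]] := bf.
have bM := bmf_cst E M; have bfM := bmfD bf bM.
have : \int[m]_x act K (fun x => f x + M) x = \int[m']_x (f x + M).
  apply/EFin_inj; rewrite !EFin_Rintegral//; last exact: bmf_act.
  under eq_integral do rewrite EFin_act//.
  rewrite -(ge0_integral_bind mK)//; first exact/measurable_EFinP/(proj1 bfM).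
  move=> y; rewrite lee_fin -lerBlDr sub0r.
  by have := fM y; rewrite ler_norml => /andP[].
rewrite (_ : act K (fun x => f x + M) = fun x => act K f x + M); last first.
  apply/funext => x; rewrite {1}/act bmf_intD//.
  by congr (_ + _); exact: act_cst.
rewrite !bmf_intD//; last exact: bmf_act.
by rewrite (prob_int_cst m1 M) (prob_int_cst m'1 M) => /addIr.
Qed.

(** * Contraction and energy under an invariant measure *)

Section invariant.
Variable mu : {measure set E -> \bar R}.
Hypotheses (mu1 : mu setT = 1%E) (muK : invariant_measure mu K).

Lemma ge0_integral_kact (f : E -> \bar R) :
  measurable_fun setT f -> (forall y, 0 <= f y)%E ->
  (\int[mu]_x kact K f x = \int[mu]_x f x)%E.
Proof.
by move=> mf f0; apply/esym/ge0_integral_bind => // A mA; rewrite muK.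
Qed.

Lemma int_act f : bmf f -> \int[mu]_x act K f x = \int[mu]_x f x.
Proof. by move=> bf; rewrite -(int_bind mu1 mu1)// => A mA; rewrite muK. Qed.

Lemma int_norm_act f : bmf f ->
  \int[mu]_x `|act K f x| <= \int[mu]_x `|f x|.
Proof.
move=> bf; rewrite -(int_act (bmf_norm bf)); apply: bmf_int_le => //.
- exact/bmf_norm/bmf_act.
- exact/bmf_act/bmf_norm.
- by move=> x; exact: bmf_int_norm.
Qed.

Definition energy f := \int[mu]_x ((f x - act K f x) * f x).

(** By invariance [K (f^2) - f^2] has integral zero, so [2 E(f)] is the integral of
    [2 (f - K f) f + K (f^2) - f^2]. Since [K (f^2) >= (K f)^2], this integrand is at least
    [(f - K f)^2]. *)
Lemma sqr_int_sub_act_le f : bmf f ->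
  (\int[mu]_x `|f x - act K f x|) ^+ 2 <= 2 * energy f.
Proof.
move=> bf; have baf := bmf_act bf; have bfa := bmfB bf baf.
have bf2 := bmfM bf bf.
apply: le_trans (sqr_int_le mu1 (bmf_norm bfa)) _.
have -> : 2 * energy f =
    \int[mu]_x (2 * ((f x - act K f x) * f x) + act K (fun y => f y * f y) x
                - f x * f x).
  rewrite bmf_intB//; last first.
    apply: bmfD; [apply: bmfM; [exact: bmf_cst|exact: bmfM]|exact: bmf_act].
  rewrite bmf_intD//; last first.
  - exact: bmf_act.
  - apply: bmfM; [exact: bmf_cst|exact: bmfM].
  by rewrite bmf_intZ ?int_act ?addrK//; exact: bmfM.
apply: bmf_int_le => //.
- by apply: bmfM; exact: bmf_norm.
- apply: bmfB => //; apply: bmfD; last exact: bmf_act.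
  apply: bmfM; [exact: bmf_cst|exact: bmfM].
- move=> x; rewrite real_normK ?num_real//.
  by have := sqr_int_le (K1 x) bf; rewrite -/(act K f x) -/(act K _ x); lra.
Qed.

Lemma energy_ge0 f : bmf f -> 0 <= energy f.
Proof.
move=> bf; rewrite -(pmulr_rge0 _ (ltr0n R 2)).
exact: le_trans (sqr_ge0 _) (sqr_int_sub_act_le bf).
Qed.

Lemma energy_le f : bmf f -> (forall x, `|f x| <= 1) ->
  energy f <= \int[mu]_x `|f x - act K f x|.
Proof.
move=> bf f1; have bfa := bmfB bf (bmf_act bf).
apply: bmf_int_le => //; [exact: bmfM|exact: bmf_norm|].
move=> x; apply: le_trans (ler_norm _) _; rewrite normrM.
by rewrite ler_piMr.
Qed.

(* Integrate [c^2 1_A(x) 1_B(y) <= (f x - f y)^2] against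
   [mu(dx) K(x, dy)]. *)
Lemma energy_ge_flow f (A B : set E) (a b : R) : bmf f ->
  measurable A -> measurable B -> b <= a ->
  (forall x, A x -> a <= f x) -> (forall x, B x -> f x <= b) ->
  (a - b) ^+ 2 * \int[mu]_x (\1_A x * act K \1_B x) <= 2 * energy f.
Proof.
move=> bf mA mB ba fA fB.
have bA := bmf_indic R mA; have bB := bmf_indic R mB.
have baB := bmf_act bB; have baf := bmf_act bf.
have bf2 := bmfM bf bf; have baf2 := bmf_act bf2.
have bff := bmfM (bmfB bf baf) bf.
have bc c : bmf (fun _ : E => c : R) by exact: bmf_cst.
have -> : 2 * energy f =
    \int[mu]_x (2 * ((f x - act K f x) * f x) + act K (fun y => f y * f y) x
                - f x * f x).
  rewrite bmf_intB//; last by apply: bmfD => //; exact: bmfM.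
  rewrite bmf_intD//; last exact: bmfM.
  by rewrite bmf_intZ// int_act// addrK.
rewrite -bmf_intZ//; last exact: bmfM.
apply: bmf_int_le => //; first by do 2 apply: bmfM => //.
  by apply: bmfB => //; apply: bmfD => //; exact: bmfM.
move=> x.
(* With the null-integral term [K (f^2) - f^2] added, the integrand becomes the [K x]-average of
   [(f x - f y)^2], so the comparison can be made pointwise in [y]. *)
have -> : 2 * ((f x - act K f x) * f x) + act K (fun y => f y * f y) x - f x * f x
    = act K (fun y => (f x - f y) ^+ 2) x.
  rewrite [X in _ = act K X x](_ : _ =
    fun y => cst (f x ^+ 2) y - (2 * f x) * f y + f y * f y); last first.
    by apply/funext => y /=; ring.
  rewrite [RHS]bmf_intD//; last by apply: bmfB => //; exact: bmfM.
  rewrite bmf_intB; [|by []|exact: (bc (f x ^+ 2))|exact: bmfM].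
  by rewrite bmf_intZ// prob_int_cst// -/(act K f x) -/(act K _ x); ring.
rewrite mulrA /act -bmf_intZ//; apply: bmf_int_le => //; first exact: bmfM.
  have bfx := bmfB (bc (f x)) bf; exact: (bmfM bfx bfx).
move=> y; rewrite !indicE.
have [Ax|_] := boolP (x \in A); last by rewrite mulr0 mul0r sqr_ge0.
have [By|_] := boolP (y \in B); last by rewrite mulr0 sqr_ge0.
rewrite !mulr1 ler_sqr ?nnegrE ?subr_ge0//.
  by apply: lerB; [exact/fA/set_mem|exact/fB/set_mem].
by apply: le_trans (fB _ (set_mem By)) (le_trans ba (fA _ (set_mem Ax))).
Qed.

End invariant.
End markov.
End kernel_action.

(** * Powers of the kernel and the resolvent series *)

Section iterates.
Context d (E : measurableType d) (R : realType).
Variable T : R.-pker E ~> E.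
Implicit Types f : E -> R.

Lemma kpow_prob n x : kpow T n x setT = 1%E.
Proof.
elim: n x => [|n ih] x /=; first by rewrite /kdirac/= diracT.
rewrite /mkcomp_noparam/= /kcomp_noparam.
under eq_integral do rewrite ih.
by rewrite integral_cst// mul1e prob_kernel.
Qed.

Lemma act_kpow0 f : bmf f -> act (kpow T 0) f = f.
Proof.
move=> [mf _]; apply/funext => x; rewrite /act /Rintegral integral_dirac//.
  by rewrite diracT mul1e.
exact/measurable_EFinP.
Qed.

(** [kpow T n.+1 x] is the mixture of the measures [kpow T n y] under [T x], which is the setting of
    [int_bind]. *)
Lemma act_kpowS n f : bmf f -> act (kpow T n.+1) f = act T (act (kpow T n) f).
Proof.
move=> bf; apply/funext => x; apply: int_bind => //.
- exact: kpow_prob.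
- exact: prob_kernel.
- exact: (kpow_prob n.+1).
Qed.

Lemma bmf_act_kpow n f : bmf f -> bmf (act (kpow T n) f).
Proof. by apply: bmf_act; exact: kpow_prob. Qed.

Section flow.
Variable mu : {measure set E -> \bar R}.
Hypotheses (mu1 : mu setT = 1%E) (muT : invariant_measure mu T).

Lemma kpow_invariant n : invariant_measure mu (kpow T n).
Proof.
elim: n => [|n ih] A mA.
  by rewrite -[in RHS](setIT A) -integral_indic.
rewrite -(ih A mA); apply: (ge0_integral_kact muT (f := fun y => kpow T n y A)) => //.
exact: measurable_kernel.
Qed.

(** Induction on [f - T^(n+1) f = (f - T f) + T (f - T^n f)], where [T] contracts the [L^1] norm. *)
Lemma int_sub_act_kpow_le n f : bmf f ->
  \int[mu]_x `|f x - act (kpow T n) f x| <=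
  n%:R * \int[mu]_x `|f x - act T f x|.
Proof.
move=> bf; have T1 := @prob_kernel _ _ _ _ _ T.
have bT := bmf_act T1 bf.
have b0 := bmfB bf bT.
elim: n => [|n ih].
  under eq_Rintegral do rewrite act_kpow0// subrr normr0.
  by rewrite mul0r (prob_int_cst mu1 0).
have bn := bmf_act_kpow n bf; have bTn := bmf_act T1 bn.
have bdn := bmfB bf bn.
have -> : (fun x => `|f x - act (kpow T n.+1) f x|) =
    fun x => `|(f x - act T f x) + act T (fun y => f y - act (kpow T n) f y) x|.
  apply/funext => x; rewrite act_kpowS// [X in _ = `|_ + X|](bmf_intB (T1 x))//.
  by rewrite -/(act T f x) -/(act T _ x) addrA subrK.
have bTd := bmf_act T1 bdn.
apply: (@le_trans _ _ (\int[mu]_x (`|f x - act T f x| +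
    `|act T (fun y => f y - act (kpow T n) f y) x|))).
  apply: bmf_int_le => //; first exact/bmf_norm/bmfD.
    by apply: bmfD; exact: bmf_norm.
  by move=> x; exact: ler_normD.
rewrite bmf_intD//; [|exact: bmf_norm..].
rewrite -natr1 mulrDl mul1r addrC lerD2r.
exact: le_trans (int_norm_act T1 mu1 muT bdn) ih.
Qed.

(** The pairing [<1_A, T^n 1_B>]: the probability that the stationary chain starts in [A] and is in
    [B] at time [n]. *)
Definition flow n (A B : set E) : R :=
  \int[mu]_x (\1_A x * act (kpow T n) \1_B x).

Lemma flow_ge0 n A B : 0 <= flow n A B.
Proof.
apply: Rintegral_ge0 => x _; apply: mulr_ge0; first by rewrite indicE.
by apply: Rintegral_ge0 => y _; rewrite indicE.
Qed.

Lemma EFin_flow n A B : measurable A -> measurable B ->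
  (flow n A B)%:E = (\int[mu]_x ((\1_A x)%:E * kpow T n x B))%E.
Proof.
move=> mA mB; have bA := bmf_indic R mA; have bB := bmf_indic R mB.
rewrite EFin_Rintegral//; last by apply: bmfM => //; exact: bmf_act_kpow.
apply: eq_integral => x _; rewrite EFinM.
by rewrite /act (prob_int_indic _ mB)//; exact: kpow_prob.
Qed.

(** All terms are nonnegative, so the series can be exchanged with the integral. *)
Lemma inner_resolvent (l : {posnum R}) A B : measurable A -> measurable B ->
  inner mu (EFin \o \1_A) (kact (resolvent l T) (EFin \o \1_B)) =
  (\sum_(n <oo) (l%:num ^+ n * flow n A B)%:E)%E.
Proof.
move=> mA mB; rewrite /inner.
transitivity (\int[mu]_x \sum_(n <oo)
    ((l%:num ^+ n)%:E * ((\1_A x)%:E * kpow T n x B)))%E.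
  apply: eq_integral => x _; rewrite /kact /= integral_indic// setIT.
  rewrite /kseries/= /mseries/= -nneseriesZl; last first.
    by move=> n _; rewrite /kscale/= /mscale mule_ge0.
  by apply: eq_eseriesr => n _; rewrite /kscale/= /mscale/= muleCA.
rewrite integral_nneseries//.
- apply: eq_eseriesr => n _; rewrite EFinM EFin_flow// ge0_integralZl//.
  apply: emeasurable_funM; last exact: measurable_kernel.
  exact/measurable_EFinP/measurable_indic.
- move=> n; apply: measurable_funeM.
  apply: emeasurable_funM; last exact: measurable_kernel.
  exact/measurable_EFinP/measurable_indic.
Qed.

End flow.
End iterates.

(** * Lower bound on the energy from positivity of the resolvent *)

Section energy_lower_bound.
Context d (E : measurableType d) (R : realType).
Variables (mu : probability E R) (T : R.-pker E ~> E).
Hypothesis muT : invariant_measure mu T.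
Implicit Types f : E -> R.

Let mu1 : mu setT = 1%E. Proof. exact: probability_setT. Qed.
Let T1 x : T x setT = 1%E. Proof. exact: prob_kernel. Qed.

Lemma sum_natM_expr_le (l : R) n : 0 < l < 1 ->
  \sum_(k < n) k%:R * l ^+ k <= l / (1 - l) ^+ 2.
Proof.
move=> /andP[l0 l1].
(* An exact formula for the partial sum; the two subtracted terms are nonnegative and get
   dropped. *)
have eqS : (1 - l) ^+ 2 * (\sum_(k < n) k%:R * l ^+ k) =
    l - n%:R * l ^+ n * (1 - l) - l ^+ n.+1.
  elim: n => [|n ih]; first by rewrite big_ord0; ring.
  by rewrite big_ord_recr /= mulrDr ih -natr1 !exprS; ring.
rewrite ler_pdivlMr ?exprn_gt0 ?subr_gt0// mulrC eqS.
have : 0 <= n%:R * l ^+ n * (1 - l).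
  by rewrite !mulr_ge0 ?exprn_ge0 ?subr_ge0// ltW.
have : 0 <= l ^+ n.+1 by rewrite exprn_ge0// ltW.
lra.
Qed.

(** [energy_ge_flow] is applied to the kernel [T^n], whose energy at [f] is at most
    [mu |f - T^n f|], hence at most [n] times the one-step quantity. *)
Lemma flow_le n f (A B : set E) (a b : R) : bmf f -> (forall x, `|f x| <= 1) ->
  measurable A -> measurable B -> b <= a ->
  (forall x, A x -> a <= f x) -> (forall x, B x -> f x <= b) ->
  (a - b) ^+ 2 * flow T mu n A B <=
  2 * (n%:R * \int[mu]_x `|f x - act T f x|).
Proof.
move=> bf f1 mA mB ba fA fB.
have muTn := kpow_invariant muT n.
apply: le_trans
  (energy_ge_flow (kpow_prob T n) mu1 muTn bf mA mB ba fA fB) _.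
rewrite ler_pM2l//.
apply: le_trans (energy_le (kpow_prob T n) mu1 bf f1) _.
exact: int_sub_act_kpow_le.
Qed.

(** The bound of [flow_le] grows linearly in [n], so it is summable against [l^n]. *)
Lemma resolvent_inner_le (l : {posnum R}) f (A B : set E) (a b : R) :
  l%:num < 1 -> bmf f -> (forall x, `|f x| <= 1) ->
  measurable A -> measurable B -> b <= a ->
  (forall x, A x -> a <= f x) -> (forall x, B x -> f x <= b) ->
  (((a - b) ^+ 2)%:E *
    inner mu (EFin \o \1_A) (kact (resolvent l T) (EFin \o \1_B)) <=
  (2 * (l%:num / (1 - l%:num) ^+ 2) * \int[mu]_x `|f x - act T f x|)%:E)%E.
Proof.
move=> l1 bf f1 mA mB ba fA fB.
set s := \int[mu]_x _.
have s0 : 0 <= s by exact: Rintegral_ge0.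
have t0 n : (0 <= (l%:num ^+ n * flow T mu n A B)%:E)%E.
  by rewrite lee_fin mulr_ge0// flow_ge0.
rewrite inner_resolvent// -nneseriesZl//.
apply: lime_le.
  by apply: is_cvg_nneseries => n _ _; rewrite mule_ge0// lee_fin sqr_ge0.
apply: nearW => n /=; rewrite big_mkord.
under eq_bigr do rewrite -EFinM.
rewrite sumEFin lee_fin.
apply: (@le_trans _ _ (\sum_(k < n) (2 * s) * (k%:R * l%:num ^+ k))).
  apply: ler_sum => k _; rewrite mulrCA.
  apply: le_trans (ler_wpM2l _ (flow_le k bf f1 mA mB ba fA fB)) _ => //.
  by rewrite -/s le_eqVlt; apply/orP; left; apply/eqP; ring.
rewrite -mulr_sumr [leRHS]mulrAC; apply: ler_wpM2l; first by rewrite mulr_ge0.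
by apply: sum_natM_expr_le; rewrite l1 andbT.
Qed.

(* Integrate [f^2 + f <= 2 1_A + r / 2]. *)
Lemma superlevel_measure_ge f (r : R) : 0 < r -> bmf f -> (forall x, `|f x| <= 1) ->
  \int[mu]_x f x = 0 -> r <= \int[mu]_x (f x ^+ 2) ->
  measurable [set x | r / 4 <= f x] /\
  ((r / 4)%:E <= mu [set x | r / 4 <= f x]%R)%E.
Proof.
move=> r0 bf f1 f0 fr; set A := [set x | _].
have mA : measurable A.
  rewrite (_ : A = f @^-1` `[r / 4, +oo[%classic).
    by rewrite -[X in measurable X]setTI; apply: (proj1 bf).
  by apply/seteqP; split => x /=; rewrite in_itv/= andbT.
split => //; rewrite -(prob_int_indic mu1 mA) lee_fin.
have bA := bmf_indic R mA; have bn := bmf_norm bf.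
have b2A : bmf (fun x => 2 * \1_A x : R) by apply: bmfM => //; exact: bmf_cst.
have bc := bmf_cst E (r / 2).
have bf2 : bmf (fun x => f x ^+ 2) by exact: bmfM.
have : \int[mu]_x (f x ^+ 2) + \int[mu]_x f x <=
    2 * \int[mu]_x \1_A x + \int[mu]_x (cst (r / 2) x).
  rewrite -bmf_intZ// -!bmf_intD//; apply: bmf_int_le; [|exact: bmfD..|].
    exact: mu1.
  move=> x /=; have fx := f1 x; move: (fx); rewrite ler_norml => /andP[fx0 fx1].
  rewrite indicE; case: (boolP (x \in A)) => [xA|].
    have : f x ^+ 2 <= 1 by nra.
    rewrite /= mulr1; have := set_mem xA; rewrite /A/=; nra.
  rewrite notin_setE/= => /negP; rewrite -ltNge => fr4.
  (* Off [A]: if [f x >= 0] then [f^2 <= f < r / 4]; if [f x < 0] then [f^2 + f <= 0], as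
     [f x >= -1]. *)
  by have [|] := leP 0 (f x); nra.
rewrite f0 (prob_int_cst mu1); lra.
Qed.

Lemma UPI_resolvent_energy (l : {posnum R}) : l%:num < 1 ->
  UPI mu (resolvent l T) ->
  forall r, 0 < r -> exists2 e : R, 0 < e &
    forall f, bmf f -> (forall x, `|f x| <= 1) -> \int[mu]_x f x = 0 ->
      r <= \int[mu]_x (f x ^+ 2) -> e <= energy T mu f.
Proof.
move=> l1 upi r r0.
have r4 : 0 < r / 4 by rewrite divr_gt0.
have [c c0 cP] : exists2 c : R, 0 < c & forall A B, measurable A ->
    measurable B -> ((r / 4)%:E <= mu A)%E -> ((r / 4)%:E <= mu B)%E ->
    (c%:E <= inner mu (EFin \o \1_A) (kact (resolvent l T) (EFin \o \1_B)))%E.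
  have := upi _ r4; set S := ereal_inf _ => S0.
  have SP A B : measurable A -> measurable B ->
      ((r / 4)%:E <= mu A)%E -> ((r / 4)%:E <= mu B)%E ->
      (S <= inner mu (EFin \o \1_A) (kact (resolvent l T) (EFin \o \1_B)))%E.
    move=> mA mB rA rB; apply: ereal_inf_lbound; exists A, B; split => //.
    by rewrite le_min rA rB.
  move: S S0 SP => [c| |]//; first by rewrite lte_fin; exists c.
  (* An infimum equal to [+oo] is no real constant, and any positive real below it serves. *)
  move=> _ SP; exists 1 => // A B mA mB rA rB.
  exact: le_trans (leey _) (SP _ _ _ _ _ _).
set L : R := l%:num / (1 - l%:num) ^+ 2.
have L0 : 0 < L by rewrite divr_gt0// exprn_gt0// subr_gt0.
(* Solves [(r / 2)^2 c <= 2 L s] for [s = mu |f - T f|], with [r / 2] the gap between the levels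
   [r / 4] and [- r / 4]. Then [s^2 <= 2 E(f)] yields the witness [k^2 / 2]. *)
set k := (r / 2) ^+ 2 * c / (2 * L).
have k0 : 0 < k by apply: divr_gt0; apply: mulr_gt0 => //; rewrite exprn_gt0// divr_gt0.
exists (k ^+ 2 / 2); first by rewrite divr_gt0 ?exprn_gt0.
move=> f bf f1 f0 fr.
have [mA rA] := superlevel_measure_ge r0 bf f1 f0 fr.
have bNf := bmfN bf.
have [|||mB rB] := @superlevel_measure_ge (fun x => - f x) r r0 bNf.
- by move=> x; rewrite normrN.
- by under eq_Rintegral do rewrite -mulN1r; rewrite bmf_intZ// f0 mulr0.
- by under eq_Rintegral do rewrite sqrrN.
have ks : k <= \int[mu]_x `|f x - act T f x|.
  rewrite /k ler_pdivrMr; last exact: mulr_gt0.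
  rewrite [leRHS]mulrC -lee_fin.
  apply: le_trans (resolvent_inner_le (a := r / 4) (b := - (r / 4))
    l1 bf f1 mA mB _ _ _).
  - rewrite opprK [r / 4 + r / 4](_ : _ = r / 2); last by field.
    by rewrite EFinM lee_pmul2l// ?lte_fin ?exprn_gt0 ?divr_gt0//; exact: cP.
  - lra.
  - by [].
  - by move=> x /=; rewrite lerNr.
have := sqr_int_sub_act_le T1 mu1 muT bf.
have : k ^+ 2 <= (\int[mu]_x `|f x - act T f x|) ^+ 2.
  by rewrite ler_sqr// nnegrE ltW//; exact: lt_le_trans ks.
lra.
Qed.

End energy_lower_bound.

(* [alpha r] is the infimum of the admissible constants, plus [1] because that
   infimum need not be attained. *)
Lemma nonincreasing_selection (R : realType) (Q : R -> R -> Prop) :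
  (forall r, 0 < r -> exists2 a, 0 <= a & Q a r) ->
  (forall a b r s, a <= b -> r <= s -> Q a r -> Q b s) ->
  exists alpha : R -> R, [/\ forall r, 0 < r -> 0 <= alpha r,
    forall r s, 0 < r -> r <= s -> alpha s <= alpha r &
    forall r, 0 < r -> Q (alpha r) r].
Proof.
move=> exQ monoQ.
pose S r := [set a | 0 <= a /\ Q a r].
have infS r : 0 < r -> has_inf (S r).
  move=> r0; have [a a0 Qa] := exQ _ r0; split; first by exists a.
  by exists 0 => b [].
have inf0 r : 0 < r -> 0 <= inf (S r).
  by move=> r0; apply: lb_le_inf; [exact: (infS r r0).1|move=> b []].
exists (fun r => inf (S r) + 1); split => [r r0|r s r0 rs|r r0].
- by rewrite addr_ge0// inf0.
- rewrite lerD2r; apply: lb_le_inf; first exact: (infS r r0).1.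
  move=> a [a0 Qa]; apply: ge_inf; first exact: (infS s (lt_le_trans r0 rs)).2.
  by split => //; exact: monoQ Qa.
- have [a [a0 Qa] ar] := inf_adherent ltr01 (infS r r0).
  by apply: monoQ Qa => //; exact: ltW.
Qed.

(** * The Dirichlet form on [L^2] and the weak Poincare inequality *)

Section dirichlet_form.
Context d (E : measurableType d) (R : realType).
Variables (mu : probability E R) (T : R.-pker E ~> E).
Hypothesis muT : invariant_measure mu T.
Implicit Types f g : E -> R.

Let mu1 : mu setT = 1%E. Proof. exact: probability_setT. Qed.
Let T1 x : T x setT = 1%E. Proof. exact: prob_kernel. Qed.

Lemma Lnorm2_sqr f : ('N[mu]_2%:E[EFin \o f] ^+ 2 = \int[mu]_x (f x ^+ 2)%:E)%E.
Proof.
have -> : (\int[mu]_x (f x ^+ 2)%:E = 'N[mu]_2%:E[EFin \o f] `^ 2)%E.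
  rewrite powR_Lnorm//; apply: eq_integral => x _ /=.
  by rewrite (powR_mulrn 2)// real_normK ?num_real.
have := Lnorm_ge0 mu 2%:E (EFin \o f).
case: ('N[mu]_2%:E[EFin \o f])%E => [r| |]//.
- by rewrite lee_fin => r0; rewrite poweR_EFin (powR_mulrn 2)// expe2 -EFinM -expr2.
- by rewrite poweRyr.
Qed.

Lemma dirichlet_bmf f : bmf f -> dirichlet mu T f = (energy T mu f)%:E.
Proof.
move=> bf; rewrite EFin_Rintegral//.
  by apply: eq_integral => x _ /=; rewrite -EFin_act.
by apply: bmfM => //; apply: bmfB => //; exact: bmf_act.
Qed.

(** For a [mu]-null set [N], invariance gives [T x N] integral zero in [x], so [N] is [T x]-null for
    [mu]-almost every [x]. *)
Lemma ae_kact f g : measurable_fun setT f -> measurable_fun setT g ->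
  (\forall x \ae mu, f x = g x) ->
  \forall x \ae mu, kact T (EFin \o f) x = kact T (EFin \o g) x.
Proof.
move=> mf mg [N [mN N0 fgN]].
have : (\int[mu]_x `|T x N| = 0)%E.
  by under eq_integral do rewrite gee0_abs//; rewrite muT.
move/(ae_eq_integral_abs mu measurableT (measurable_kernel T N mN)).
apply: filterS => x /(_ I) TN.
apply: ae_eq_integral => //; [exact/measurable_EFinP..|].
exists N; split => // y /= fgy; apply: fgN => /= fgE.
by apply: fgy => _; rewrite fgE.
Qed.

Lemma measurable_dirichlet_integrand f : measurable_fun setT f ->
  measurable_fun setT
    (fun x => ((EFin \o f) \- kact T (EFin \o f)) x * (EFin \o f) x)%E.
Proof.
move=> mf; have mEf : measurable_fun setT (EFin \o f) by exact/measurable_EFinP.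
apply: emeasurable_funM => //; apply: emeasurable_funB => //.
exact: measurable_kact.
Qed.

Lemma eq_dirichlet f g : measurable_fun setT f -> measurable_fun setT g ->
  (\forall x \ae mu, f x = g x) -> dirichlet mu T f = dirichlet mu T g.
Proof.
move=> mf mg fg; have Tfg := ae_kact mf mg fg.
apply: ae_eq_integral => //; [exact: measurable_dirichlet_integrand..|].
by apply: filterS2 fg Tfg => x /= -> -> _.
Qed.

(* Excludes [-oo + +oo = -oo] on the right-hand side of the inequality when
   [osc f = +oo]. Pointwise, [(f - T f) f >= - T (f^2)], because
   [|f x| |f y| <= f x ^ 2 + f y ^ 2]. *)
Lemma dirichlet_gtNy f : f \in Lfun mu 2%:E -> (-oo < dirichlet mu T f)%E.
Proof.
move=> f2; have := Lfun2_integrable_sqr f2 => /integrableP[mf2 f2fin].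
have mf : measurable_fun setT f by exact: set_mem (sub_Lfun_mfun f2).
have mEf : measurable_fun setT (EFin \o f) by exact/measurable_EFinP.
set F := fun x => (((EFin \o f) \- kact T (EFin \o f)) x * (EFin \o f) x)%E.
set Q := kact T (fun y => (f y ^+ 2)%:E).
have Q0 x : (0 <= Q x)%E by apply: integral_ge0 => y _; rewrite lee_fin sqr_ge0.
have FQ x : (- F x <= Q x)%E.
  rewrite /F /=; set t := f x.
  have [Qx|Qx] := eqVneq (Q x) +oo%E; first by rewrite Qx leey.
  have Qfin : Q x \is a fin_num by rewrite ge0_fin_numE// ltey.
  set I := (\int[T x]_y `|(f y)%:E|)%E.
  have mnf : measurable_fun setT (fun y => `|(f y)%:E|)%E by exact: measurableT_comp.
  (* Integrates [c |f y| <= c^2 + f y ^ 2]. The value [c = 1] shows that [I] is finite, and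
     [c = |t|] gives the bound on [- F x]. *)
  have bnd (c : R) : (0 <= c)%R -> (c%:E * I <= (c ^+ 2)%:E + Q x)%E.
    move=> c0; rewrite -ge0_integralZl//.
    have -> : ((c ^+ 2)%:E = \int[T x]_y (c ^+ 2)%:E)%E.
      by rewrite integral_cst// T1 mule1.
    rewrite -ge0_integralD//; last 2 first.
    - by move=> y _; rewrite lee_fin sqr_ge0.
    - by move=> y _; rewrite lee_fin sqr_ge0.
    apply: ge0_le_integral => //.
    - by move=> y _; rewrite mule_ge0// lee_fin.
    - exact: measurable_funeM.
    - exact: emeasurable_funD.
    - move=> y _; rewrite /= -EFinM -EFinD lee_fin.
      have := normr_ge0 (f y); rewrite -[f y ^+ 2]real_normK ?num_real//.
      by move: `|f y| => z z0; nra.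
  have Ifin : I \is a fin_num.
    have I0 : (0 <= I)%E by exact: integral_ge0.
    rewrite ge0_fin_numE//; have := bnd 1%R ler01; rewrite mul1e => /le_lt_trans; apply.
    by rewrite lte_add_pinfty ?ltry// ltey.
  have kI : (`|kact T (EFin \o f) x| <= I)%E by exact: le_abse_integral.
  have kfin : kact T (EFin \o f) x \is a fin_num.
    rewrite fin_num_abs; apply: le_lt_trans kI _.
    by rewrite -ge0_fin_numE//; exact: integral_ge0.
  have := bnd `|t| (normr_ge0 t); move: kI Qfin.
  rewrite -(fineK kfin) -(fineK Ifin).
  case: (Q x) => [q| |]// + _.
  rewrite abse_EFin -EFinB -!EFinM -EFinN -EFinD !lee_fin.
  set y := fine _; set i := fine _ => yi.
  rewrite real_normK ?num_real// => ti.
  have : t * y <= `|t| * `|y| by rewrite -normrM ler_norm.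
  have : `|t| * `|y| <= `|t| * i by rewrite ler_wpM2l.
  lra.
have mF : measurable_fun setT F by exact: measurable_dirichlet_integrand.
rewrite /dirichlet /inner -/F integralE.
(* [F^-] is at most [Q], whose integral is that of [f^2] by invariance. *)
have fin : (\int[mu]_x F^\- x < +oo)%E.
  apply: (@le_lt_trans _ _ (\int[mu]_x Q x)%E).
    apply: ge0_le_integral => //.
    - exact: measurable_funeneg.
    - by apply: measurable_kact.
    - by move=> x _; rewrite funenegE ge_max FQ Q0.
  rewrite (ge0_integral_kact muT)//; last by move=> y; rewrite lee_fin sqr_ge0.
  apply: le_lt_trans f2fin; rewrite le_eqVlt; apply/orP; left; apply/eqP.
  by apply: eq_integral => x _; rewrite /= ger0_norm// sqr_ge0.
have P0 : (0 <= \int[mu]_x F^\+ x)%E by exact: integral_ge0.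
have N0 : (0 <= \int[mu]_x F^\- x)%E by exact: integral_ge0.
case: (\int[mu]_x F^\+ x)%E P0 => [p| |]//;
  case: (\int[mu]_x F^\- x)%E N0 fin => [n| |]//.
by move=> _ _ _; rewrite -EFinB ltNyr.
Qed.

Lemma energyZ c f : bmf f -> energy T mu (fun x => c * f x) = c ^+ 2 * energy T mu f.
Proof.
move=> bf; have bT := bmf_act T1 bf.
rewrite /energy -bmf_intZ//; last by apply: bmfM => //; exact: bmfB.
apply: eq_Rintegral => x _.
have -> : act T (fun y => c * f y) x = c * act T f x by exact: (bmf_intZ (T1 x)).
by ring.
Qed.

Lemma ess_clip f : measurable_fun setT f -> osc mu f \is a fin_num ->
  exists u v : R, [/\ v <= u, osc mu f = (u - v)%:E &
    \forall x \ae mu, v <= f x <= u].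
Proof.
move=> mf; rewrite /osc.
(* A difference of extended reals is finite only if both terms are. *)
move: (ess_supr mu f) (ess_infr mu f) (ess_sup_ge mu (EFin \o f))
  (ess_inf_le mu (EFin \o f)) => [u| |] [v| |] //= fu fv _.
have vfu : \forall x \ae mu, v <= f x <= u.
  by apply: filterS2 fu fv => x; rewrite !lee_fin => -> ->.
exists u, v; split => //.
have PF : ProperFilter (almost_everywhere mu).
  by apply: ae_properfilter_algebraOfSetsType; rewrite [X in (_ < X)%E]mu1.
by have [x /andP[vf /(le_trans vf)]] := filter_ex vfu.
Qed.

(** The inequality is proved first for bounded functions under a sup-norm bound [w], then
    transferred by truncating [f] at its essential bounds. *)
Lemma RUPI_osc2_WPI : RUPI mu T -> osc2_WPI mu T.
Proof.
move=> [l [l1 upi]].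
pose Q (a r : R) := forall f (w : R), bmf f -> 0 <= w -> (forall x, `|f x| <= w) ->
  \int[mu]_x f x = 0 -> \int[mu]_x (f x ^+ 2) <= a * energy T mu f + r * w ^+ 2.
have [||alpha [a0 amono aQ]] := @nonincreasing_selection R Q.
- move=> r r0; have [e e0 eP] := UPI_resolvent_energy muT l1 upi r0.
  (* After scaling by [w^-1], either the variance is below [r], and the term [r w^2] suffices, or
     [E(f) >= e w^2], and [mu (f^2) <= w^2 <= e^-1 E(f)]. *)
  exists e^-1; first by rewrite invr_ge0 ltW.
  move=> f w bf w0 fw f0.
  have En0 := energy_ge0 T1 mu1 muT bf.
  have bf2 : bmf (fun x => f x ^+ 2) by exact: bmfM.
  have f2w : \int[mu]_x (f x ^+ 2) <= w ^+ 2.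
    rewrite -(prob_int_cst mu1 (w ^+ 2)); apply: bmf_int_le => //.
      exact: bmf_cst.
    by move=> x /=; rewrite -[leLHS]real_normK ?num_real// ler_sqr ?nnegrE.
  have [w00|wn0] := eqVneq w 0.
    rewrite w00 expr0n/= in f2w *; rewrite mulr0 addr0.
    by apply: le_trans f2w _; rewrite mulr_ge0// invr_ge0 ltW.
  have {wn0}w0 : 0 < w by rewrite lt0r wn0.
  have bg : bmf (fun x => w^-1 * f x) by apply: bmfM => //; exact: bmf_cst.
  have g1 x : `|w^-1 * f x| <= 1.
    by rewrite normrM gtr0_norm ?invr_gt0// ler_pdivrMl// mulr1.
  have g0 : \int[mu]_x (w^-1 * f x) = 0 by rewrite bmf_intZ// f0 mulr0.
  have g2 : \int[mu]_x ((w^-1 * f x) ^+ 2) = (w ^+ 2)^-1 * \int[mu]_x (f x ^+ 2).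
    rewrite -bmf_intZ//; apply: eq_Rintegral => x _.
    by rewrite exprMn exprVn.
  have w20 : 0 < w ^+ 2 by rewrite exprn_gt0.
  have [rg|gr] := leP r (\int[mu]_x ((w^-1 * f x) ^+ 2)); last first.
    move: gr; rewrite g2 ltr_pdivrMl// mulrC => gr.
    apply: le_trans (ltW gr) _; rewrite lerDr mulr_ge0// invr_ge0 ltW//.
  have := eP _ bg g1 g0 rg; rewrite energyZ// exprVn ler_pdivlMl// => eE.
  apply: le_trans f2w _; rewrite -[leLHS]addr0; apply: lerD.
    by rewrite ler_pdivlMl// mulrC.
  by rewrite mulr_ge0// ltW.
- move=> a b r s ab rs Qa f w bf w0 fw f0; apply: le_trans (Qa f w bf w0 fw f0) _.
  apply: lerD; first by apply: ler_wpM2r => //; exact: energy_ge0.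
  by apply: ler_wpM2r => //; exact: sqr_ge0.
exists alpha; split => // r f r0 [f2 f0].
have mf : measurable_fun setT f by exact: set_mem (sub_Lfun_mfun f2).
(* A non-finite oscillation has square [+oo]. As the Dirichlet form is above [-oo], the right-hand
   side is [+oo], also when [alpha r = 0], where [0 * +oo = 0]. *)
have [oscfin|oscinf] := boolP (osc mu f \is a fin_num); last first.
  have -> : (osc mu f ^+ 2 = +oo)%E.
    by move: oscinf; rewrite expe2; case: (osc mu f) => [s| |].
  rewrite gt0_muley ?lte_fin//.
  have := dirichlet_gtNy f2; case: (dirichlet mu T f) => [D| |] // _.
    by rewrite -EFinM addey// leey.
  have := a0 _ r0; rewrite le_eqVlt => /predU1P[<-|ar].
    by rewrite mul0e add0e leey.
  by rewrite gt0_muley ?lte_fin// leey.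
have [u [v [vu -> fuv]]] := ess_clip mf oscfin.
pose g x := Num.max v (Num.min u (f x)).
have mg : measurable_fun setT g.
  apply: measurable_maxr; first exact: measurable_cst.
  by apply: measurable_minr => //; exact: measurable_cst.
have gv x : v <= g x by rewrite le_max lexx.
have gu x : g x <= u by rewrite ge_max vu ge_min lexx.
have bg : bmf g.
  split => //; exists (`|u| + `|v|) => x; have := gv x; have := gu x.
  have := ler_norm u; have := ler_norm (- v); rewrite normrN ler_norml.
  by have := normr_ge0 u; have := normr_ge0 v; lra.
have fg : \forall x \ae mu, f x = g x.
  by apply: filterS fuv => x /andP[vf fu]; rewrite /g min_r// max_r.
have g0 : \int[mu]_x g x = 0.
  apply: EFin_inj; rewrite EFin_Rintegral// -[RHS]f0; apply/esym.
  apply: ae_eq_integral => //; [exact/measurable_EFinP..|].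
  by apply: filterS fg => x -> _.
rewrite Lnorm2_sqr (eq_dirichlet mf mg fg) dirichlet_bmf//.
have -> : (\int[mu]_x (f x ^+ 2)%:E = \int[mu]_x (g x ^+ 2)%:E)%E.
  apply: ae_eq_integral => //.
  - by apply/measurable_EFinP; exact: measurable_funX.
  - by apply/measurable_EFinP; exact: measurable_funX.
  - by apply: filterS fg => x -> _.
rewrite -EFin_Rintegral//; last exact: bmfM.
rewrite expe2 -!EFinM -EFinD lee_fin -expr2.
(* Mean zero gives [v <= 0 <= u], hence [|g| <= u - v], and the oscillation can serve as [w]. *)
have v0 : v <= 0.
  by rewrite -g0 -(prob_int_cst mu1 v); apply: bmf_int_le => //; exact: bmf_cst.
have u0 : 0 <= u.
  by rewrite -g0 -(prob_int_cst mu1 u); apply: bmf_int_le => //; exact: bmf_cst.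
apply: aQ => //; first by rewrite subr_ge0.
by move=> x; rewrite ler_norml; have := gv x; have := gu x; lra.
Qed.

End dirichlet_form.

(** * From the weak Poincare inequality to positivity of the resolvent *)

Section resolvent_lower_bound.
Context d (E : measurableType d) (R : realType).
Variables (mu : probability E R) (T : R.-pker E ~> E).
Hypothesis muT : invariant_measure mu T.
Implicit Types f g h : E -> R.

Let mu1 : mu setT = 1%E. Proof. exact: probability_setT. Qed.
Let T1 x : T x setT = 1%E. Proof. exact: prob_kernel. Qed.

Lemma bmf_Lfun2 f : bmf f -> f \in Lfun mu 2%:E.
Proof.
move=> bf; apply/andP; split; rewrite inE; first exact: (proj1 bf).
rewrite /= /finite_norm; have := Lnorm2_sqr mu f.
rewrite -EFin_Rintegral//; last exact: bmfM.
by case: ('N[mu]_2%:E[EFin \o f])%E => [r| |]//; rewrite ltry.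
Qed.

(** The constant cancels in [f - T f], and in the other factor it contributes
    [c mu (f - T f) = 0]. *)
Lemma energy_subr_cst f c : bmf f ->
  energy T mu (fun x => f x - c) = energy T mu f.
Proof.
move=> bf; have bT := bmf_act T1 bf; have bc := bmf_cst E c.
have bd := bmfB bf bT.
have -> : energy T mu (fun x => f x - c) =
    \int[mu]_x ((f x - act T f x) * f x - c * (f x - act T f x)).
  apply: eq_Rintegral => x _.
  have -> : act T (fun y => f y - c) x = act T f x - c.
    by rewrite [LHS](bmf_intB (T1 x))// (prob_int_cst (T1 x) c).
  ring.
rewrite bmf_intB//; [|exact: bmfM..].
by rewrite bmf_intZ// bmf_intB// int_act// subrr mulr0 subr0.
Qed.

(* Write [h - T h = u - (q^-1 - 1) h - q^-1 e] with
   [u = q^-1 (h + e) - T h >= 0]; then [(h - T h) h <= u] as [0 <= h <= 1]. *)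
Lemma energy_almost_excessive_le h (q e : R) : bmf h -> 0 < q <= 1 -> 0 <= e ->
  (forall x, 0 <= h x <= 1) -> (forall x, act T h x <= q^-1 * (h x + e)) ->
  energy T mu h <= q^-1 - 1 + q^-1 * e.
Proof.
move=> bh /andP[q0 q1] e0 h01 Th.
have bT := bmf_act T1 bh; have bd := bmfB bh bT.
have bc c := bmf_cst E (c : R).
have q1' : 1 <= q^-1 by rewrite invf_ge1.
have bhe : bmf (fun x => q^-1 * (h x + e)) by apply: bmfM => //; exact: bmfD.
apply: (@le_trans _ _ (\int[mu]_x (q^-1 * (h x + e) - act T h x))).
  apply: bmf_int_le => //; [exact: bmfM|exact: bmfB|].
  move=> x; have /andP[h0 h1] := h01 x.
  have u0 : 0 <= q^-1 * (h x + e) - act T h x by rewrite subr_ge0.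
  apply: (@le_trans _ _ ((q^-1 * (h x + e) - act T h x) * h x)).
    apply: ler_wpM2r => //; rewrite lerD2r -[leLHS]mul1r.
    by apply: ler_pM => //; rewrite lerDl.
  by rewrite ler_piMr.
have h1 : \int[mu]_x h x <= 1.
  rewrite -[leRHS](prob_int_cst mu1); apply: bmf_int_le => //; first exact: bc.
  by move=> x; have /andP[] := h01 x.
rewrite bmf_intB// int_act// bmf_intZ//; last exact: bmfD.
rewrite bmf_intD// (prob_int_cst mu1 e).
nra.
Qed.

(** With [m] the mean of [h], integrate [(1 - m) 1_B + (m - h) 1_A <= 2 |h - m|]; the masses of [A]
    and [B] enter with weights [m] and [1 - m], which add up to [1]. *)
Lemma mean_deviation_ge h (A B : set E) (eps : R) : bmf h ->
  measurable A -> measurable B -> (eps%:E <= mu A)%E -> (eps%:E <= mu B)%E ->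
  (forall x, 0 <= h x <= 1) -> (forall x, B x -> h x = 1) ->
  eps - \int[mu]_x (\1_A x * h x) <=
  2 * \int[mu]_x `|h x - \int[mu]_x h x|.
Proof.
move=> bh mA mB eA eB h01 hB.
have bA := bmf_indic R mA; have bB := bmf_indic R mB.
have bc c := bmf_cst E (c : R).
set m := \int[mu]_x h x.
have m1 : m <= 1.
  rewrite -[leRHS](prob_int_cst mu1); apply: bmf_int_le => //; first exact: bc.
  by move=> x; have /andP[] := h01 x.
have m0 : 0 <= m by apply: Rintegral_ge0 => x _; have /andP[] := h01 x.
rewrite -(prob_int_indic mu1 mA) lee_fin in eA.
rewrite -(prob_int_indic mu1 mB) lee_fin in eB.
have bAh := bmfM bA bh.
have bmA : bmf (fun x => m * \1_A x) by exact: bmfM.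
have bmB : bmf (fun x => (1 - m) * \1_B x) by exact: bmfM.
have bhm : bmf (fun x => `|h x - m|) by apply: bmf_norm; exact: bmfB.
have : \int[mu]_x ((1 - m) * \1_B x + (m * \1_A x - \1_A x * h x)) <=
    \int[mu]_x (2 * `|h x - m|).
  apply: bmf_int_le => //; [by apply: bmfD => //; exact: bmfB|exact: bmfM|].
  move=> x.
  have hm := ler_norm (h x - m); have hm' := ler_norm (- (h x - m)).
  rewrite normrN in hm'; have n0 := normr_ge0 (h x - m).
  rewrite !indicE; case: (boolP (x \in B)) => [/set_mem/hB xB|_].
    by case: (x \in A); rewrite /=; lra.
  by case: (x \in A); rewrite /=; lra.
rewrite bmf_intD//; last exact: bmfB.
rewrite bmf_intB// !bmf_intZ//; nra.
Qed.

(** * The truncated resolvent and its cutoff at one *)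

Section truncated_resolvent.
Variables (B : set E) (q : R) (N : nat).
Hypotheses (mB : measurable B) (q01 : 0 < q < 1).

Let q0 : 0 < q. Proof. by case/andP: q01. Qed.

(** The weight [q] is to be taken close to [1], independently of the resolvent parameter [l];
    stopping at [N] lets a factor [l^N] make up for the difference. *)
Definition trunc_resolvent x : R :=
  \sum_(k < N.+1) q ^+ k * act (kpow T k) \1_B x.

Definition excessive_cutoff x : R := Num.min (trunc_resolvent x) 1.

Let bB : bmf (\1_B : E -> R). Proof. exact: bmf_indic. Qed.

Let bterm k : bmf (fun x => q ^+ k * act (kpow T k) \1_B x).
Proof. by apply: bmfM; [exact: bmf_cst|exact: bmf_act_kpow]. Qed.

Let act_ge0 k x : 0 <= act (kpow T k) \1_B x.
Proof. by apply: Rintegral_ge0 => y _; rewrite indicE. Qed.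

Let term_ge0 k x : 0 <= q ^+ k * act (kpow T k) \1_B x.
Proof. by apply: mulr_ge0 => //; exact/exprn_ge0/ltW. Qed.

Let bmf_trunc_resolvent : bmf trunc_resolvent.
Proof. exact: (@bmf_sum _ _ _ (fun k x => q ^+ k * act (kpow T k) \1_B x)). Qed.

Lemma bmf_excessive_cutoff : bmf excessive_cutoff.
Proof. by apply: bmf_min => //; exact: bmf_cst. Qed.

Lemma excessive_cutoff_itv x : 0 <= excessive_cutoff x <= 1.
Proof.
rewrite /excessive_cutoff le_min ler01 ge_min lexx orbT !andbT.
by apply: sumr_ge0 => k _; exact: term_ge0.
Qed.

Lemma excessive_cutoff1 x : B x -> excessive_cutoff x = 1.
Proof.
move=> Bx; rewrite /excessive_cutoff min_r// /trunc_resolvent big_ord_recl.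
have t0 : 1 <= q ^+ 0 * act (kpow T 0) \1_B x.
  by rewrite act_kpow0// indicE mem_set// expr0 mulr1.
rewrite -[leLHS]addr0; apply: lerD => //.
by apply: sumr_ge0 => k _; exact: term_ge0.
Qed.

(** [q T g] is [g] with its first term [1_B] removed and [q^(N+1) T^(N+1) 1_B <= q^(N+1)] added. *)
Lemma act_trunc_resolvent_le x :
  act T trunc_resolvent x <= q^-1 * (trunc_resolvent x + q ^+ N.+1).
Proof.
rewrite ler_pdivlMl//.
have -> : act T trunc_resolvent x =
    \sum_(k < N.+1) q ^+ k * act (kpow T k.+1) \1_B x.
  rewrite [LHS](@bmf_int_sum _ _ _ _ (T1 x)
    (fun k x => q ^+ k * act (kpow T k) \1_B x))//.
  apply: eq_bigr => k _; rewrite act_kpowS//.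
  exact: (bmf_intZ (T1 x) _ (bmf_act_kpow T k bB)).
rewrite mulr_sumr /trunc_resolvent.
under eq_bigr do rewrite mulrA -exprS.
rewrite big_ord_recr [in leRHS]big_ord_recl.
apply: lerD.
  by rewrite -[leLHS]add0r; apply: lerD; [exact: (term_ge0 0)|].
rewrite -[leRHS]mulr1; apply: ler_wpM2l; first exact/exprn_ge0/ltW.
rewrite -(act_cst (kpow_prob T N.+1) 1 x).
by apply: (act_le (kpow_prob T N.+1)) => //; exact: bmf_cst.
Qed.

(** Monotonicity of [T] gives [T h <= T g] and [T h <= 1]; each bound handles one argument of the
    minimum. *)
Lemma act_excessive_cutoff_le x :
  act T excessive_cutoff x <= q^-1 * (excessive_cutoff x + q ^+ N.+1).
Proof.
have bh := bmf_excessive_cutoff.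
have qN : 0 <= q ^+ N.+1 by exact/exprn_ge0/ltW.
rewrite {2}/excessive_cutoff addr_minl [leRHS](_ : _ =
  Num.min (q^-1 * (trunc_resolvent x + q ^+ N.+1)) (q^-1 * (1 + q ^+ N.+1))).
  rewrite le_min; apply/andP; split.
    apply: le_trans _ (act_trunc_resolvent_le x).
    by apply: act_le => // y; rewrite ge_min lexx.
  apply: (@le_trans _ _ 1).
    rewrite -[leRHS](act_cst T1 1 x); apply: act_le => //; first exact: bmf_cst.
    by move=> y; have /andP[] := excessive_cutoff_itv y.
  by rewrite ler_pdivlMl// mulr1; case/andP: q01; lra.
by rewrite -minr_pMr// invr_ge0 ltW.
Qed.

Lemma int_excessive_cutoff_le (A : set E) : measurable A ->
  \int[mu]_x (\1_A x * excessive_cutoff x) <=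
  \sum_(k < N.+1) q ^+ k * flow T mu k A B.
Proof.
move=> mA; have bA := bmf_indic R mA; have bh := bmf_excessive_cutoff.
apply: (@le_trans _ _ (\int[mu]_x (\1_A x * trunc_resolvent x))).
  apply: bmf_int_le => //; [exact: bmfM..|].
  move=> x; apply: ler_wpM2l; first by rewrite indicE.
  by rewrite ge_min lexx.
have -> : \int[mu]_x (\1_A x * trunc_resolvent x) =
    \int[mu]_x (\sum_(k < N.+1) \1_A x * (q ^+ k * act (kpow T k) \1_B x)).
  by apply: eq_Rintegral => x _; rewrite mulr_sumr.
rewrite (@bmf_int_sum _ _ _ _ mu1
  (fun k x => \1_A x * (q ^+ k * act (kpow T k) \1_B x))); last first.
  by move=> k; exact: bmfM.
rewrite le_eqVlt; apply/orP; left; apply/eqP; apply: eq_bigr => k _.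
rewrite /flow -bmf_intZ//; last by apply: bmfM => //; exact: bmf_act_kpow.
by apply: eq_Rintegral => x _; rewrite mulrCA.
Qed.

End truncated_resolvent.

(** Keep the terms of index at most [N] and use [l^N q^k <= l^N <= l^k]. *)
Lemma resolvent_inner_ge (l : {posnum R}) (q : R) N (A B : set E) :
  l%:num <= 1 -> 0 <= q <= 1 -> measurable A -> measurable B ->
  ((l%:num ^+ N * \sum_(k < N.+1) q ^+ k * flow T mu k A B)%:E <=
   inner mu (EFin \o \1_A) (kact (resolvent l T) (EFin \o \1_B)))%E.
Proof.
move=> l1 /andP[q0 q1] mA mB; rewrite inner_resolvent//.
apply: le_trans (nneseries_lim_ge (m := 0) (P := xpredT) N.+1 _); last first.
  by move=> n _ _; rewrite lee_fin mulr_ge0// flow_ge0.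
rewrite big_mkord sumEFin lee_fin mulr_sumr; apply: ler_sum => k _.
rewrite mulrA; apply: ler_wpM2r; first exact: flow_ge0.
apply: (@le_trans _ _ (l%:num ^+ N)).
  by rewrite ler_piMr// exprn_ile1.
by apply: ler_wiXn2l => //; rewrite -ltnS.
Qed.

Lemma osc2_WPI_bmf (a r : R) f (u v : R) :
  (L20 mu f -> 'N[mu]_2%:E[EFin \o f] ^+ 2 <=
    a%:E * dirichlet mu T f + r%:E * osc mu f ^+ 2)%E ->
  0 <= r -> bmf f -> \int[mu]_x f x = 0 ->
  (forall x, v <= f x <= u) -> u - v <= 1 ->
  \int[mu]_x (f x ^+ 2) <= a * energy T mu f + r.
Proof.
move=> wpi r0 bf f0 vfu uv1.
have f20 : L20 mu f.
  by split; [exact: bmf_Lfun2|rewrite -EFin_Rintegral// f0].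
have := wpi f20; rewrite Lnorm2_sqr -EFin_Rintegral//; last exact: bmfM.
rewrite dirichlet_bmf//.
have mu_gt0 : (0 < mu setT)%E by rewrite mu1.
have sup_le : (ess_supr mu f <= u%:E)%E.
  by apply: ess_sup_ler => x; rewrite lee_fin; have /andP[] := vfu x.
have inf_ge : (v%:E <= ess_infr mu f)%E.
  by apply: ess_inf_ler => x; rewrite lee_fin; have /andP[] := vfu x.
have sup_ge : (v%:E <= ess_supr mu f)%E.
  by apply: ess_sup_ger => // x; rewrite lee_fin; have /andP[] := vfu x.
(* This order makes the oscillation nonnegative, so that the bound [1] passes to its square. *)
have inf_le : (ess_infr mu f <= ess_supr mu f)%E.
  have PF : ProperFilter (almost_everywhere mu).
    exact: ae_properfilter_algebraOfSetsType.
  have [x []] := filter_ex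
    (filterI (ess_inf_le mu (EFin \o f)) (ess_sup_ge mu (EFin \o f))).
  exact: le_trans.
have sup_fin : ess_supr mu f \is a fin_num.
  by rewrite fin_numElt (lt_le_trans (ltNyr v) sup_ge) (le_lt_trans sup_le (ltry u)).
have inf_fin : ess_infr mu f \is a fin_num.
  rewrite fin_numElt (lt_le_trans (ltNyr v) inf_ge).
  exact: le_lt_trans inf_le (le_lt_trans sup_le (ltry u)).
move: sup_fin inf_fin sup_le inf_ge inf_le; rewrite /osc.
case: (ess_supr mu f) => [s| |]// _; case: (ess_infr mu f) => [i| |]// _.
rewrite !lee_fin => su vi is_.
move/le_trans; apply.
rewrite lerD2l ler_piMr// mulr_ile1 ?subr_ge0//; lra.
Qed.

Lemma osc2_WPI_RUPI : osc2_WPI mu T -> RUPI mu T.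
Proof.
move=> [alpha [a0 _ wpi]].
exists (2^-1)%:pos; split; first by rewrite /= invf_lt1// ltr1n.
move=> eps eps0.
(* Chosen so that the inequality bounds the variance of [h] by
   [alpha r * (2 kap) + r <= eps^2 / 32]. The [+ 1] in [kap] covers [alpha r = 0]. *)
set r := eps ^+ 2 / 64; have r0 : 0 < r by rewrite divr_gt0 ?exprn_gt0.
have ar0 := a0 _ r0.
set kap := eps ^+ 2 / 128 / (alpha r + 1).
have kap0 : 0 < kap.
  by apply: divr_gt0; [rewrite divr_gt0// exprn_gt0|rewrite ltr_wpDl].
have akap : alpha r * kap <= eps ^+ 2 / 128.
  rewrite /kap mulrCA ler_piMr//.
    by rewrite divr_ge0// exprn_ge0// ltW.
  by rewrite ler_pdivrMr ?ltr_wpDl// mul1r lerDl.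
(* Makes [q^-1 - 1] equal to [kap]; with [q^N <= kap] the energy of [h] is at most [2 kap]. *)
set q := (1 + kap)^-1.
have q01 : 0 < q < 1.
  by rewrite /q invr_gt0 addr_gt0//= invf_lt1 ?addr_gt0// ltrDl.
have qV : q^-1 - 1 = kap by rewrite /q invrK addrC addKr.
have /andP[q0 q1] := q01.
have [N qN] : exists N, q ^+ N <= kap.
  have : (GRing.exp q : nat -> R) @ \oo --> (0 : R).
    by apply: cvg_expr; rewrite gtr0_norm.
  move=> /cvgrPdist_le /(_ _ kap0) [N _ /(_ N (leqnn N))] /=.
  by rewrite sub0r normrN gtr0_norm ?exprn_gt0// => ?; exists N.
(* [N] is fixed before [A] and [B], so this lower bound is uniform over all admissible pairs. *)
apply: (@lt_le_trans _ _ ((2^-1 ^+ N * (eps / 2))%:E)).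
  by rewrite lte_fin mulr_gt0// divr_gt0.
apply: le_ereal_inf_tmp => _ [A [B [mA mB + ->]]].
rewrite le_min => /andP[eA eB].
apply: le_trans _ (resolvent_inner_ge (q := q) N _ _ mA mB); last 2 first.
- by rewrite /= invf_le1// ler1n.
- by rewrite !ltW.
rewrite lee_fin ler_wpM2l// leNgt; apply/negP => small.
set h := excessive_cutoff B q N.
have bh : bmf h by exact: bmf_excessive_cutoff.
have h01 := excessive_cutoff_itv B N q01.
set m := \int[mu]_x h x.
have bhm : bmf (fun x => h x - m) by apply: bmfB => //; exact: bmf_cst.
have dev := mean_deviation_ge bh mA mB eA eB h01 (excessive_cutoff1 N mB q01).
have hA := int_excessive_cutoff_le q N mB mA.
have En : energy T mu h <= kap + q ^+ N.
  rewrite -qV -(mulKf (lt0r_neq0 q0) (q ^+ N)) -exprS.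
  apply: energy_almost_excessive_le => //.
  - by rewrite q0 ltW.
  - by exact/exprn_ge0/ltW.
  - exact: act_excessive_cutoff_le.
have := osc2_WPI_bmf (u := 1 - m) (v := - m) (wpi r (fun x => h x - m) r0) (ltW r0) bhm.
rewrite energy_subr_cst//; have V := sqr_int_le mu1 (bmf_norm bhm).
set s := \int[mu]_x `|_| in dev V.
have -> : \int[mu]_x ((h x - m) ^+ 2) = \int[mu]_x (`|h x - m| ^+ 2).
  by apply: eq_Rintegral => x _; rewrite real_normK ?num_real.
have hm0 : \int[mu]_x (h x - m) = 0.
  by rewrite bmf_intB// ?(prob_int_cst mu1 m) ?subrr//; exact: bmf_cst.
have hm01 x : - m <= h x - m <= 1 - m.
  by have /andP[] := h01 x; rewrite -/h; lra.
move=> /(_ hm0 hm01); have -> : 1 - m - - m = 1 by ring.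
move=> /(_ (lexx _)) wpih.
have aE : alpha r * energy T mu h <= alpha r * (2 * kap).
  by apply: ler_wpM2l => //; lra.
(* From [dev], [hA] and [small]. Then [s^2 > eps^2 / 16], against [V] and the bound [eps^2 / 32] on
   the variance. *)
have : eps / 4 < s by lra.
rewrite /r in wpih; nra.
Qed.

End resolvent_lower_bound.

Theorem theorem43 (d : measure_display) (E : measurableType d) (R : realType)
    (mu : probability E R) (T : R.-pker E ~> E)
    (hE : measurable [set xy : E * E | xy.1 = xy.2])
    (hT : invariant_measure mu T) :
  osc2_WPI mu T <-> RUPI mu T.
Proof. by split; [exact: osc2_WPI_RUPI|exact: RUPI_osc2_WPI]. Qed.
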